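(* For $n\in\mathbb{Z}^+$ let $$\mathcal{P}_n=\Big\{(X,Y,\alpha): Y>0,\ \tfrac2n\le X\le\tfrac2{n-1},\ nX-n(n+1)Y-1\ge0,\ \alpha\in[0,\pi]\Big\},$$ where $X\le\frac2{n-1}$ is omitted if $n=1$. For $r_3>1$ and a fixed integer $k_0\ge n$, let $K_n=K_n(r_3)$ be the set defined in the context, written in the coordinates $(X,Y,\alpha)$, and for $n\ge2$ let $\tilde K_n=\tilde K_n(r_3)$ be the subset of $K_n(r_3)$ of points satisfying in addition $\frac2n\le X\le\frac2{n-1}$ and $nX-n(n+1)Y-1\ge0$. Then: (a) For any given integer $n\ge2$, the set $\mathcal{P}_n$ is the limit of $\tilde K_n(r_3)$ as $r_3$ tends to $1$. (b) Any compact (in the $(X,Y)$-coordinates) subset of $\mathcal{P}_1$, that is, any set $C\times[0,\pi]\subset\mathcal{P}_1$ with $C\subset\{(X,Y):Y>0\}$ compact, is the limit, as $r_3$ tends to $1$, of compact subsets of $K_1(r_3)$; i.e. there exist compact sets $CK_1(r_3)\subset K_1(r_3)$ whose limit as $r_3\to1$ is $C\times[0,\pi]$.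
   Context: **Limit.** The limit as $r_3\to1^+$ of a family of sets $A(r_3)\subset\{(X,Y,\alpha):Y>0\}$ is understood in the Kuratowski sense inside $\{Y>0\}$: the limit is $L$ if every point of $L$ is a limit of points $a(r_3)\in A(r_3)$ as $r_3\to1^+$, and every point of $\{Y>0\}$ that is the limit of a sequence $a_i\in A(r_3^{(i)})$ with $r_3^{(i)}\to1^+$ belongs to $L$. **Coordinates.** $(X,Y)=\left(\frac{r_1^2-1}{r_2^2-1}-1,\ \frac1{r_2^2-1}\right)$, equivalently $r_1=\sqrt{1+\frac{X+1}{Y}}$, $r_2=\sqrt{1+\frac1Y}$. **Notation.** Fix $r_3>1$ and put $s_3=\sqrt{r_3^2-1}$ (so $r_3=\cosh(m_3/2)$, $s_3=\sinh(m_3/2)$ for some $m_3>0$). For a positive integer $n$, $$t_n=\frac{A_0+A_1+A_2}{2r_1r_2s_3\big((r_3+s_3)^{2n+1}+(r_3-s_3)^{2n+1}-2r_3\big)},$$ $A_0=(r_3-s_3)^{2n+2}\big((2r_1^2r_3^2-r_1^2+r_2^2)s_3+2r_1^2r_3(r_3^2-1)\big)$, $A_1=(r_3+s_3)^{2n+2}\big((2r_1^2r_3^2-r_1^2+r_2^2)s_3-2r_1^2r_3(r_3^2-1)\big)$, $A_2=-2s_3(r_1^2+r_2^2+2r_3^2-2)$. $a_0=4r_1^2r_2^2r_3^4+r_3^2(r_1^2-r_2^2)^2-r_1^2-r_2^2-r_3^2+1$, $a_1=2r_1r_2r_3(1-2r_3^2(r_1^2+r_2^2))$, $a_2=4r_1^2r_2^2r_3^2$;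 $v_j=\frac{(r_3+s_3)^j-(r_3-s_3)^j}{(r_3+s_3)^j+(r_3-s_3)^j}$; $f(t)=\frac{\sqrt{x_0-x_1t}-\sqrt{y_0-y_1t}}{\sqrt{x_0-x_1t}+\sqrt{y_0-y_1t}}$ with $x_0=r_1^2(r_3+s_3)^2+r_2^2$, $x_1=2r_1r_2(r_3+s_3)$, $y_0=r_1^2(r_3-s_3)^2+r_2^2$, $y_1=2r_1r_2(r_3-s_3)$. **The sets $K_n(r_3)$.** Fix a positive integer $k_0$. The parameter domain consists of $(r_1,r_2,\alpha)$ with $\alpha\in[0,\pi]$, $1<r_3\le r_2\le r_1$ and $\cos\alpha\le\frac{r_1^2+r_2^2+r_3^2-1}{2r_1r_2r_3}$ (the condition that $\alpha$ be the angular invariant of an actual complex hyperbolic ultra-parallel triangle group with parameters $r_1,r_2,r_3$). For $1\le n\le k_0$, $K_n(r_3)$ is the set of points of this domain with $t_n\le t_k$ for all integers $k\ne n$, $1\le k\le k_0+1$, and (i) $r_1^2+r_2^2-2r_1r_2r_3t_n\ge0$; (ii) $2r_3^2(r_1^2+r_2^2)-4r_1r_2r_3t_n-1\ge0$; (iii) $a_2t_n^2+a_1t_n+a_0\ge0$; (iv) $v_{k_0+2}-f(1)\ge0$. *)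

(* Defs.v *)
From HB Require Import structures.
From mathcomp Require Import all_boot all_order all_algebra.
From mathcomp Require Import all_classical all_reals all_analysis.

Set Implicit Arguments.
Unset Strict Implicit.
Unset Printing Implicit Defensive.

Import Order.TTheory GRing.Theory Num.Theory.
Import numFieldNormedType.Exports.

Local Open Scope classical_set_scope.
Local Open Scope ring_scope.

Section Functions.
Context {R : realType}.

Definition s3 (r3 : R) : R := Num.sqrt (r3 ^+ 2 - 1).

Definition A0 (r1 r2 r3 : R) (n : nat) : R :=
  (r3 - s3 r3) ^+ (2 * n + 2) *
  ((2 * r1 ^+ 2 * r3 ^+ 2 - r1 ^+ 2 + r2 ^+ 2) * s3 r3
   + 2 * r1 ^+ 2 * r3 * (r3 ^+ 2 - 1)).

Definition A1 (r1 r2 r3 : R) (n : nat) : R :=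
  (r3 + s3 r3) ^+ (2 * n + 2) *
  ((2 * r1 ^+ 2 * r3 ^+ 2 - r1 ^+ 2 + r2 ^+ 2) * s3 r3
   - 2 * r1 ^+ 2 * r3 * (r3 ^+ 2 - 1)).

Definition A2 (r1 r2 r3 : R) : R :=
  - 2 * s3 r3 * (r1 ^+ 2 + r2 ^+ 2 + 2 * r3 ^+ 2 - 2).

Definition tn (r1 r2 r3 : R) (n : nat) : R :=
  (A0 r1 r2 r3 n + A1 r1 r2 r3 n + A2 r1 r2 r3) /
  (2 * r1 * r2 * s3 r3 *
   ((r3 + s3 r3) ^+ (2 * n + 1) + (r3 - s3 r3) ^+ (2 * n + 1) - 2 * r3)).

Definition a0 (r1 r2 r3 : R) : R :=
  4 * r1 ^+ 2 * r2 ^+ 2 * r3 ^+ 4 + r3 ^+ 2 * (r1 ^+ 2 - r2 ^+ 2) ^+ 2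
  - r1 ^+ 2 - r2 ^+ 2 - r3 ^+ 2 + 1.

Definition a1 (r1 r2 r3 : R) : R :=
  2 * r1 * r2 * r3 * (1 - 2 * r3 ^+ 2 * (r1 ^+ 2 + r2 ^+ 2)).

Definition a2 (r1 r2 r3 : R) : R := 4 * r1 ^+ 2 * r2 ^+ 2 * r3 ^+ 2.

Definition v (r3 : R) (j : nat) : R :=
  ((r3 + s3 r3) ^+ j - (r3 - s3 r3) ^+ j) /
  ((r3 + s3 r3) ^+ j + (r3 - s3 r3) ^+ j).

Definition x0 (r1 r2 r3 : R) : R := r1 ^+ 2 * (r3 + s3 r3) ^+ 2 + r2 ^+ 2.
Definition x1 (r1 r2 r3 : R) : R := 2 * r1 * r2 * (r3 + s3 r3).
Definition y0 (r1 r2 r3 : R) : R := r1 ^+ 2 * (r3 - s3 r3) ^+ 2 + r2 ^+ 2.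
Definition y1 (r1 r2 r3 : R) : R := 2 * r1 * r2 * (r3 - s3 r3).

Definition f (r1 r2 r3 t : R) : R :=
  (Num.sqrt (x0 r1 r2 r3 - x1 r1 r2 r3 * t)
   - Num.sqrt (y0 r1 r2 r3 - y1 r1 r2 r3 * t)) /
  (Num.sqrt (x0 r1 r2 r3 - x1 r1 r2 r3 * t)
   + Num.sqrt (y0 r1 r2 r3 - y1 r1 r2 r3 * t)).

End Functions.

Section Regions.
Context {R : realType}.

(* Points ((r1, r2), alpha); the cosine bound says that alpha is the angular
   invariant of an actual complex hyperbolic ultra-parallel triangle group. *)
Definition param_domain (r3 : R) : set (R * R * R) :=
  [set p | let: (r1, r2, alpha) := p in
    [/\ 0 <= alpha <= pi, 1 < r3, r3 <= r2, r2 <= r1 &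
        cos alpha <=
          (r1 ^+ 2 + r2 ^+ 2 + r3 ^+ 2 - 1) / (2 * r1 * r2 * r3)]].

Definition Kparam (k0 n : nat) (r3 : R) : set (R * R * R) :=
  [set p | param_domain r3 p /\
    let: (r1, r2, _) := p in
    let t := tn r1 r2 r3 in
    [/\ (forall k : nat, (1 <= k <= k0.+1)%N -> k <> n -> t n <= t k),
        r1 ^+ 2 + r2 ^+ 2 - 2 * r1 * r2 * r3 * t n >= 0,
        2 * r3 ^+ 2 * (r1 ^+ 2 + r2 ^+ 2) - 4 * r1 * r2 * r3 * t n - 1 >= 0,
        a2 r1 r2 r3 * t n ^+ 2 + a1 r1 r2 r3 * t n + a0 r1 r2 r3 >= 0 &
        v r3 (k0 + 2)%N - f r1 r2 r3 1 >= 0]].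

(* (r1, r2, alpha) |-> (X, Y, alpha); on r1, r2 > 1 it is injective with inverse
   r1 = sqrt (1 + (X + 1) / Y), r2 = sqrt (1 + 1 / Y). *)
Definition XYcoord (p : R * R * R) : R * R * R :=
  let: (r1, r2, alpha) := p in
  ((r1 ^+ 2 - 1) / (r2 ^+ 2 - 1) - 1, 1 / (r2 ^+ 2 - 1), alpha).

Definition K (k0 n : nat) (r3 : R) : set (R * R * R) :=
  XYcoord @` Kparam k0 n r3.

(* The upper bound on X is guarded because 2 / 0 = 0 here. *)
Definition XYcond (n : nat) (X Y : R) : Prop :=
  [/\ 2 / n%:R <= X, ((1 < n)%N -> X <= 2 / (n%:R - 1)) &
      n%:R * X - n%:R * (n%:R + 1) * Y - 1 >= 0].

Definition P (n : nat) : set (R * R * R) :=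
  [set p | let: (X, Y, alpha) := p in
    [/\ 0 < Y, XYcond n X Y & 0 <= alpha <= pi]].

Definition Ktilde (k0 n : nat) (r3 : R) : set (R * R * R) :=
  [set p | K k0 n r3 p /\ let: (X, Y, _) := p in XYcond n X Y].

Definition upper : set (R * R * R) := [set p | 0 < p.1.2].

(* Kuratowski limit of A r3 as r3 -> 1^+ in the ambient space {Y > 0}. In the
   second clause a needs to be a selection of A only near 1^+, since A r3 may be
   empty for larger r3. *)
Definition klimit (A : R -> set (R * R * R)) (L : set (R * R * R)) : Prop :=
  [/\ L `<=` upper,
      (forall p, L p -> exists a : R -> R * R * R,
         (\forall r3 \near 1^'+, A r3 (a r3)) /\ a r3 @[r3 --> 1^'+] --> p) &
      (forall p, upper p ->
         forall (r : nat -> R) (a : nat -> R * R * R),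
         (forall i, 1 < r i) -> r i @[i --> \oo] --> (1 : R) ->
         (forall i, A (r i) (a i)) -> a i @[i --> \oo] --> p -> L p)].

End Regions.

(* Main.v *)
Require Import Defs.
From mathcomp Require Import all_boot all_order all_algebra.
From mathcomp Require Import all_classical all_reals all_analysis.
From mathcomp Require Import ring lra.

(* Put r3 = cosh m and U_k = sinh (k m) / sinh m. Then
   2 r1 r2 t_k = (r1^2 U_k^2 + r2^2 U_{k+1}^2 - 1) / (U_k U_{k+1}), and as
   r3 -> 1 we have U_k -> k, so that
   2 r1 r2 t_k -> r1^2 + r2^2 + (1/k - (X+1)/(k+1)) / Y.
   Hence in the limit t_n <= t_k for all k means 2/n <= X <= 2/(n-1). With
   W = (nX-1) / (n(n+1)Y), condition (iii) becomes W (W-1) >= 0, while (i) and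
   (ii) become W >= 0 and 2W >= 1, and (iv) follows from
   r2 U_{k0+2} <= r1 U_{k0+1}. On the interior of P_n all of these hold strictly
   in the limit, so by continuity a neighbourhood of an interior point lies in
   K_n(r3) for r3 close to 1. Points of P_n are then reached by moving them
   into the interior (towards an interior point in (a), by X |-> X + h in (b))
   by an amount h(r3) -> 0. *)

Set Implicit Arguments.
Unset Strict Implicit.
Unset Printing Implicit Defensive.

Import Order.TTheory GRing.Theory Num.Theory.
Import numFieldNormedType.Exports.

Local Open Scope classical_set_scope.
Local Open Scope ring_scope.

(** * Algebraic form of t_k and of the conditions on K_n for r3 > 1 *)

Section Algebra.
Context {R : realType}.
Implicit Types (a b c r alpha X Y : R) (k n j : nat).

(* With c = cosh m, U c k = sinh (k m) / sinh m; writing it as a sum makes it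
   continuous at c = 1, where it equals k. *)
Definition U c k : R :=
  \sum_(i < k) (c + s3 c) ^+ (k.-1 - i) * (c - s3 c) ^+ i.

(* T (r1^2) (r2^2) r3 k = 2 r1 r2 t_k, see tn_T. *)
Definition T a b c k : R :=
  (a * U c k ^+ 2 + b * U c k.+1 ^+ 2 - 1) / (U c k * U c k.+1).

Lemma s3_gt0 c : 1 < c -> 0 < s3 c.
Proof. by move=> c1; rewrite /s3 sqrtr_gt0; nra. Qed.

Lemma sqr_s3 c : 1 < c -> s3 c ^+ 2 = c ^+ 2 - 1.
Proof. by move=> c1; rewrite /s3 sqr_sqrtr//; nra. Qed.

Lemma mul_pm_s3 c : 1 < c -> (c + s3 c) * (c - s3 c) = 1.
Proof. by move=> c1; have := sqr_s3 c1; lra. Qed.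

Lemma subr_s3_gt0 c : 1 < c -> 0 < c - s3 c.
Proof. by move=> c1; have := mul_pm_s3 c1; have := s3_gt0 c1; nra. Qed.

Lemma U_gt0 c k : 1 < c -> 0 < U c k.+1.
Proof.
move=> c1; have s0 := s3_gt0 c1; have e0 := subr_s3_gt0 c1.
have e1 : 0 < c + s3 c by lra.
rewrite /U big_ord_recl ltr_pwDl//; first by rewrite mulr_gt0// exprn_gt0.
by apply: sumr_ge0 => i _; rewrite mulr_ge0// exprn_ge0// ltW.
Qed.

Lemma subXX_U c k : (c + s3 c) ^+ k - (c - s3 c) ^+ k = 2 * s3 c * U c k.
Proof. by rewrite subrXX /U; congr (_ * _); ring. Qed.

(** Numerator and denominator of t_k both contain the factor [s3 c ^+ 3]; cancelling it removes the
    0/0 at r3 = 1. *)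
Lemma tn_T r1 r2 c k : 1 < c -> 0 < r1 -> 0 < r2 ->
  2 * r1 * r2 * tn r1 r2 c k.+1 = T (r1 ^+ 2) (r2 ^+ 2) c k.+1.
Proof.
move=> c1 r10 r20; have s0 := s3_gt0 c1; have ss := sqr_s3 c1.
have u0 := U_gt0 k c1; have v0 := U_gt0 k.+1 c1.
have ee := mul_pm_s3 c1.
have EU := subXX_U c k.+1; have EV := subXX_U c k.+2.
have EE : (c + s3 c) ^+ k.+1 * (c - s3 c) ^+ k.+1 = 1.
  by rewrite -exprMn ee expr1n.
(* Write e, e' for c + s3 and c - s3. The brackets in [A0] and [A1] factor as s3 (r1^2 e^2 + r2^2)
   and s3 (r1^2 e'^2 + r2^2), and e e' = 1 does the rest. *)
have num : A0 r1 r2 c k.+1 + A1 r1 r2 c k.+1 + A2 r1 r2 c =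
   4 * s3 c ^+ 3 * (r1 ^+ 2 * U c k.+1 ^+ 2 + r2 ^+ 2 * U c k.+2 ^+ 2 - 1).
  move: EV; rewrite /A0 /A1 /A2 exprD mulnC exprM (exprS _ k.+1) (exprS _ k.+1).
  rewrite exprD exprM.
  move: EU EE ee.
  set E := (c + s3 c) ^+ k.+1; set E' := (c - s3 c) ^+ k.+1.
  set e := c + s3 c; set e' := c - s3 c => EU EE ee EV.
  have e2 : 2 * r1 ^+ 2 * c ^+ 2 - r1 ^+ 2 = r1 ^+ 2 * (c ^+ 2 + s3 c ^+ 2).
    by rewrite ss; ring.
  rewrite e2 -ss.
  have -> : 4 * s3 c ^+ 3
    * (r1 ^+ 2 * U c k.+1 ^+ 2 + r2 ^+ 2 * U c k.+2 ^+ 2 - 1)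
    = s3 c * (r1 ^+ 2 * (2 * s3 c * U c k.+1) ^+ 2
      + r2 ^+ 2 * (2 * s3 c * U c k.+2) ^+ 2 - 4 * s3 c ^+ 2) by ring.
  rewrite -EU -EV.
  have H1 : (r1 ^+ 2 * (c ^+ 2 + s3 c ^+ 2) + r2 ^+ 2) * s3 c
    + 2 * r1 ^+ 2 * c * s3 c ^+ 2 = s3 c * (r1 ^+ 2 * e ^+ 2 + r2 ^+ 2).
    by rewrite /e; ring.
  have H2 : (r1 ^+ 2 * (c ^+ 2 + s3 c ^+ 2) + r2 ^+ 2) * s3 c
    - 2 * r1 ^+ 2 * c * s3 c ^+ 2 = s3 c * (r1 ^+ 2 * e' ^+ 2 + r2 ^+ 2).
    by rewrite /e'; ring.
  rewrite H1 H2.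
  have H3 : 2 * c ^+ 2 - 2 = 2 * s3 c ^+ 2 by rewrite ss; ring.
  have -> : r1 ^+ 2 + r2 ^+ 2 + 2 * c ^+ 2 - 2 =
     r1 ^+ 2 + r2 ^+ 2 + 2 * s3 c ^+ 2 by rewrite -H3; ring.
  transitivity (s3 c * (r1 ^+ 2 * ((E ^+ 2 + E' ^+ 2) * (e * e') ^+ 2)
    + r2 ^+ 2 * ((E * e) ^+ 2 + (E' * e') ^+ 2)
    - 2 * (r1 ^+ 2 + r2 ^+ 2 + 2 * s3 c ^+ 2))); first by ring.
  have -> : (E - E') ^+ 2 = E ^+ 2 + E' ^+ 2 - 2 * (E * E') by ring.
  have -> : (e * E - e' * E') ^+ 2 = (E * e) ^+ 2 + (E' * e') ^+ 2
     - 2 * ((E * E') * (e * e')) by ring.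
  by rewrite EE ee; ring.
have den : (c + s3 c) ^+ (2 * k.+1 + 1) + (c - s3 c) ^+ (2 * k.+1 + 1) - 2 * c
    = 4 * s3 c ^+ 2 * (U c k.+1 * U c k.+2).
  have -> : 4 * s3 c ^+ 2 * (U c k.+1 * U c k.+2)
    = (2 * s3 c * U c k.+1) * (2 * s3 c * U c k.+2) by ring.
  rewrite -EU -EV (exprS _ k.+1) (exprS _ k.+1).
  rewrite !exprD mulnC !exprM expr1.
  have -> : 2 * c = ((c + s3 c) ^+ k.+1 * (c - s3 c) ^+ k.+1)
      * ((c + s3 c) + (c - s3 c)) by rewrite EE; ring.
  by ring.
rewrite /tn num den /T; field.
by rewrite !gt_eqF.
Qed.

(** At t = 1 both radicands are perfect squares, so f(1) = (P - Q) / (P + Q) with P = r1 (c + s3) -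
    r2 and Q = |r1 (c - s3) - r2|. Cross-multiplying with [v] leaves E' P <= E Q, where E, E' are
    the powers of c + s3 and c - s3 with exponent j+1. *)
Lemma f1_le_v r1 r2 c j : 1 < c -> 0 < r2 -> r2 <= r1 ->
  r2 * U c j.+1 <= r1 * U c j -> f r1 r2 c 1 <= v c j.+1.
Proof.
move=> c1 r20 r21 le_rU; have s0 := s3_gt0 c1; have e'0 := subr_s3_gt0 c1.
have ee := mul_pm_s3 c1; have EU := subXX_U c j; have EV := subXX_U c j.+1.
have e1 : 1 < c + s3 c by lra.
rewrite /f /v.
have -> : x0 r1 r2 c - x1 r1 r2 c * 1 = (r1 * (c + s3 c) - r2) ^+ 2.
  by rewrite /x0 /x1; ring.
have -> : y0 r1 r2 c - y1 r1 r2 c * 1 = (r1 * (c - s3 c) - r2) ^+ 2.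
  by rewrite /y0 /y1; ring.
have P0 : 0 < r1 * (c + s3 c) - r2 by nra.
rewrite !sqrtr_sqr (gtr0_norm P0).
have := ler_norm (r1 * (c - s3 c) - r2).
have := normr_ge0 (r1 * (c - s3 c) - r2).
set Q := `|_| => Q0 leQ.
have E0 : 0 < (c + s3 c) ^+ j.+1 by rewrite exprn_gt0//; lra.
have E'0 : 0 < (c - s3 c) ^+ j.+1 by rewrite exprn_gt0.
rewrite ler_pdivrMr; last by rewrite ltr_wpDr.
rewrite mulrAC ler_pdivlMr; last by rewrite addr_gt0.
suff : (c - s3 c) ^+ j.+1 * (r1 * (c + s3 c) - r2) <= (c + s3 c) ^+ j.+1 * Q.
  by nra.
(* Without the absolute value in [Q], the two sides differ by 2 s3 (r1 U_j - r2 U_{j+1}). *)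
apply: (@le_trans _ _ ((c + s3 c) ^+ j.+1 * (r1 * (c - s3 c) - r2)));
  last by rewrite ler_pM2l.
rewrite -subr_ge0.
have -> : (c + s3 c) ^+ j.+1 * (r1 * (c - s3 c) - r2) -
   (c - s3 c) ^+ j.+1 * (r1 * (c + s3 c) - r2)
   = r1 * (((c + s3 c) * (c - s3 c)) * ((c + s3 c) ^+ j - (c - s3 c) ^+ j))
     - r2 * ((c + s3 c) ^+ j.+1 - (c - s3 c) ^+ j.+1).
  by rewrite !exprS; ring.
rewrite ee EU EV.
have -> : r1 * (1 * (2 * s3 c * U c j)) - r2 * (2 * s3 c * U c j.+1) =
  2 * s3 c * (r1 * U c j - r2 * U c j.+1) by ring.
by rewrite mulr_ge0 ?subr_ge0// mulr_ge0// ltW.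
Qed.

(** Stated in a = r1^2 and b = r2^2, so that no square root of these enters the limits. Only the
    range of alpha matters: the squared inequality makes the upper bound for cos alpha at least
    1. *)
Lemma K_sufficient k0 n c X Y alpha (a := 1 + (X + 1) / Y) (b := 1 + 1 / Y) :
  (1 <= n)%N -> 1 < c -> 0 <= alpha <= pi -> 0 < Y -> 0 <= X ->
  c ^+ 2 <= b -> 4 * a * b * c ^+ 2 <= (a + b + c ^+ 2 - 1) ^+ 2 ->
  (forall k, (1 <= k <= k0.+1)%N -> k <> n -> T a b c n <= T a b c k) ->
  0 <= a + b - c * T a b c n ->
  0 <= 2 * c ^+ 2 * (a + b) - 2 * c * T a b c n - 1 ->
  0 <= c ^+ 2 * T a b c n ^+ 2 + c * T a b c n * (1 - 2 * c ^+ 2 * (a + b))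
    + (4 * a * b * c ^+ 4 + c ^+ 2 * (a - b) ^+ 2 - a - b - c ^+ 2 + 1) ->
  b * U c k0.+2 ^+ 2 <= a * U c k0.+1 ^+ 2 ->
  K k0 n c (X, Y, alpha).
Proof.
case: n => // n _ c1 halpha Y0 X0 hcb hcos hT h1 h2 h3 h4.
have Yi0 : 0 < 1 / Y by rewrite divr_gt0.
have XYi : 1 / Y <= (X + 1) / Y by rewrite ler_pM2r ?invr_gt0//; lra.
have b0 : 0 < b by rewrite /b; lra.
have ab : b <= a by rewrite /a /b; lra.
have a0 : 0 < a by lra.
pose r1 := Num.sqrt a; pose r2 := Num.sqrt b.
have r1a : r1 ^+ 2 = a by rewrite sqr_sqrtr ?ltW.
have r2b : r2 ^+ 2 = b by rewrite sqr_sqrtr ?ltW.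
have r10 : 0 < r1 by rewrite sqrtr_gt0.
have r20 : 0 < r2 by rewrite sqrtr_gt0.
have r21 : r2 <= r1 by rewrite ler_sqrt// ltW.
have c0 : 0 < c by lra.
have [r1p r2p cp] := And3 (ltW r10) (ltW r20) (ltW c0).
have tT k : (1 <= k)%N -> 2 * r1 * r2 * tn r1 r2 c k = T a b c k.
  by case: k => // k _; rewrite tn_T// r1a r2b.
exists (r1, r2, alpha); last first.
  rewrite /XYcoord r1a r2b /a /b; congr (_, _, _).
    by field; rewrite gt_eqF//=; apply/eqP; lra.
  by field; rewrite gt_eqF//=; apply/eqP; lra.
split.
  split => //.
    by rewrite -(ler_pXn2r (n := 2)) ?nnegrE// r2b.
  apply: (le_trans (cos_le1 _)).
  rewrite ler_pdivlMr ?mulr_gt0// mul1r r1a r2b.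
  rewrite -(ler_pXn2r (n := 2)) ?nnegrE//; last 2 first.
  - by rewrite !mulr_ge0.
  - by nra.
  by rewrite !exprMn r1a r2b; lra.
have tE := tT n.+1 isT.
have cE : 2 * r1 * r2 * c * tn r1 r2 c n.+1 = c * T a b c n.+1.
  by rewrite -tE; ring.
split.
- move=> k hk kn; have /andP[k1 _] := hk.
  rewrite -(@ler_pM2l _ (2 * r1 * r2)) ?mulr_gt0// tE tT//.
  exact: hT.
- by rewrite r1a r2b cE.
- rewrite r1a r2b.
  have -> : 4 * r1 * r2 * c * tn r1 r2 c n.+1 = 2 * c * T a b c n.+1.
    by rewrite -[RHS]mulrA -cE; ring.
  exact: h2.
- rewrite /a2 /a1 /Defs.a0 r1a r2b.
  have -> : 4 * a * b * c ^+ 2 * tn r1 r2 c n.+1 ^+ 2 =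
     c ^+ 2 * T a b c n.+1 ^+ 2.
    by rewrite -tE !exprMn r1a r2b; ring.
  have -> : 2 * r1 * r2 * c * (1 - 2 * c ^+ 2 * (a + b)) * tn r1 r2 c n.+1
    = c * T a b c n.+1 * (1 - 2 * c ^+ 2 * (a + b)) by rewrite -cE; ring.
  exact: h3.
- rewrite subr_ge0 addn2 f1_le_v//.
  have u0 := ltW (U_gt0 k0 c1); have v0 := ltW (U_gt0 k0.+1 c1).
  by rewrite -(ler_pXn2r (n := 2)) ?nnegrE ?mulr_ge0// !exprMn r1a r2b.
Qed.

End Algebra.

(** * Limits as r3 tends to 1, along an arbitrary filter *)

Section Limits.
Context {R : realType} {I : Type} (F : set_system I) {FF : Filter F}.
Implicit Types (g : I -> R).

Lemma cvg_exprn g (l : R) n : g i @[i --> F] --> l ->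
  g i ^+ n @[i --> F] --> l ^+ n.
Proof.
move=> gl; elim: n => [|n IHn]; first exact: cvg_cst.
rewrite exprS; under eq_fun do rewrite exprS. exact: cvgM.
Qed.

Context (c : I -> R) (c1 : c i @[i --> F] --> (1 : R)).

Lemma cvg_s3 : s3 (c i) @[i --> F] --> (0 : R).
Proof.
have -> : 0 = Num.sqrt (1 ^+ 2 - 1) :> R by rewrite expr1n subrr sqrtr0.
apply: (cvg_comp (fun i => c i ^+ 2 - 1)); last exact: sqrt_continuous.
by apply: cvgB; [exact: cvg_exprn|exact: cvg_cst].
Qed.

Lemma cvg_U k : U (c i) k @[i --> F] --> (k%:R : R).
Proof.
have -> : k%:R = \sum_(j < k) (1 + 0) ^+ (k.-1 - j) * (1 - 0) ^+ j :> R.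
  under eq_bigr do rewrite addr0 subr0 !expr1n mulr1.
  by rewrite sumr_const card_ord.
apply: cvg_big => [|j _]; first exact: add_continuous.
by apply: cvgM; apply: cvg_exprn; [apply: cvgD|apply: cvgB] => //;
  exact: cvg_s3.
Qed.

Lemma cvg_T (a b : I -> R) (la lb : R) k :
  a i @[i --> F] --> la -> b i @[i --> F] --> lb ->
  T (a i) (b i) (c i) k.+1 @[i --> F] -->
    (la * k.+1%:R ^+ 2 + lb * k.+2%:R ^+ 2 - 1) / (k.+1%:R * k.+2%:R).
Proof.
move=> ala blb; apply: cvgM.
  apply: cvgB; last exact: cvg_cst.
  by apply: cvgD; apply: cvgM => //; apply: cvg_exprn; exact: cvg_U.
apply: cvgV; first by rewrite mulf_neq0 ?pnatr_eq0.
by apply: cvgM; exact: cvg_U.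
Qed.

End Limits.

(** * A displacement depending on r3 and tending to 0 *)

Section Selection.
Context {R : realType}.

(** Exchanges quantifiers: a fixed displacement is admissible only for r close to 1, depending on
    it, while a Kuratowski limit asks for one selection that converges as r tends to 1. *)
Lemma vanishing_selection (B : R -> R -> Prop) :
  (forall h, 0 < h -> h < 1 -> \forall r \near 1^'+, B r h) ->
  exists h : R -> R, h r @[r --> 1^'+] --> (0 : R) /\
    \forall r \near 1^'+, 0 < h r < 1 /\ B r (h r).
Proof.
move=> HB.
(* Near-minimal choice: h r exceeds the infimum of S r by less than r - 1. *)
pose S (r : R) := [set h | 0 < h < 1 /\ B r h].
pose h (r : R) := xget 0 (S r `&` [set h | h < inf (S r) + (r - 1)]).
have lbS r : has_lbound (S r) by exists 0 => x [/andP[/ltW]].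
have hP r e : 1 < r -> S r e -> S r (h r) /\ h r < e + (r - 1).
  move=> r1 Se; have [||x Sx xlt] := @inf_adherent _ (S r) (r - 1).
  - by rewrite subr_gt0.
  - by split; [exists e|exact: lbS].
  have [|Sh hlt] := @xgetPex _ 0 (S r `&` [set h | h < inf (S r) + (r - 1)]).
    by exists x.
  split=> //; apply: (lt_le_trans hlt); rewrite lerD2r.
  exact: (ge_inf (lbS r) Se).
(* The value 1/2 only witnesses that [S r] is nonempty for r near 1, so that the default 0 of [xget]
   is not taken there. *)
have h01 : \forall r \near 1^'+, 0 < h r < 1 /\ B r (h r).
  have hh : 0 < (2^-1 : R) < 1 by lra.
  near=> r; apply: (@proj1 _ (h r < 2^-1 + (r - 1))); apply: hP => //.
  by split => //; near: r; apply: HB; lra.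
exists h; split => //.
apply/cvgr0Pnorm_lt => e e0.
(* [e'] is below 1, hence admissible, and 2 e' <= e leaves room for the slack r - 1 < e'. *)
pose e' := Num.min e 1 / 2.
have e'0 : 0 < e' by rewrite /e' divr_gt0// lt_min e0 ltr01.
have e'1 : e' < 1 by rewrite /e' ltr_pdivrMr// mul1r gt_min ltr1n orbT.
have e'e : 2 * e' <= e by rewrite /e' mulrC divfK// ge_min lexx.
near=> r.
have r1 : 1 < r by near: r; exact: nbhs_right_gt.
have Se' : S r e' by split; [exact/andP|near: r; exact: HB].
have [[/andP[h0 h1] _] hlt] := hP _ _ r1 Se'.
rewrite gtr0_norm//; apply: (lt_le_trans hlt).
have : r < 1 + e' by near: r; apply: nbhs_right_lt; lra.
by lra.
Unshelve. all: by end_near. Qed.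

End Selection.

(** * Strict inequalities in the limit, and the interior of P_n *)

Section Near.
Context {R : realType}.

Lemma T_limit (X Y : R) k (a := 1 + (X + 1) / Y) (b := 1 + 1 / Y) : 0 < Y ->
  (a * k.+1%:R ^+ 2 + b * k.+2%:R ^+ 2 - 1) / (k.+1%:R * k.+2%:R) =
  a + b + (k.+1%:R^-1 - (X + 1) / k.+2%:R) / Y.
Proof.
move=> Y0; rewrite /a /b -[k.+2%:R]natr1.
have : 0 < k.+1%:R :> R by [].
move: k.+1%:R => K K0; field.
by rewrite !gt_eqF//; lra.
Qed.

(** With N = n+1 and K = k+1, the difference has the sign of (N - K) (N + K + 1 - X N K). If K > N,
    then X N K > 2 K >= N + K + 1; if K < N, the upper bound on X gives X N K < N + K + 1. The
    neighbours K = N + 1 and K = N - 1 are the tight cases. *)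
Lemma T_limit_lt (X : R) n k : (k <> n)%N ->
  2 / n.+1%:R < X -> ((1 < n.+1)%N -> X < 2 / (n.+1%:R - 1)) ->
  n.+1%:R^-1 - (X + 1) / n.+2%:R < k.+1%:R^-1 - (X + 1) / k.+2%:R.
Proof.
move=> kn; rewrite ltr_pdivrMr ?ltr0n// => X1 X2; rewrite -subr_gt0.
have -> : k.+1%:R^-1 - (X + 1) / k.+2%:R - (n.+1%:R^-1 - (X + 1) / n.+2%:R) =
  (n.+1%:R - k.+1%:R) * (n.+2%:R * k.+2%:R - (X + 1) * (n.+1%:R * k.+1%:R))
   / (n.+1%:R * n.+2%:R * (k.+1%:R * k.+2%:R)).
  rewrite -[k.+2%:R]natr1 -[n.+2%:R]natr1.
  have : 0 < k.+1%:R :> R by [].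
  have : 0 < n.+1%:R :> R by [].
  move: k.+1%:R n.+1%:R => K N K0 N0; field.
  by rewrite !gt_eqF//; lra.
apply: divr_gt0; last by rewrite !mulr_gt0.
rewrite -[k.+2%:R]natr1 -[n.+2%:R]natr1.
have k1 : 1 <= k.+1%:R :> R by rewrite ler1n.
have n1 : 1 <= n.+1%:R :> R by rewrite ler1n.
case: (ltngtP n k) => [nk|nk|//]; last 1 first.
- by move=> nk; case: kn.
- have : n.+1%:R + 1 <= k.+1%:R :> R by rewrite natr1 ler_nat.
  move: k1 n1 X1 => {X2}; set N := n.+1%:R; set K := k.+1%:R => k1 n1 X1 h.
  rewrite nmulr_lgt0; first by lra.
  have : 2 * K < X * N * K by rewrite ltr_pM2r//; lra.
  by lra.
have n0 : (0 < n)%N by case: (n) nk.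
have := X2 n0.
have : k.+1%:R + 1 <= n.+1%:R :> R by rewrite natr1 ler_nat.
move: k1 n1 X1 => {X2}; set N := n.+1%:R; set K := k.+1%:R => k1 n1 X1 h.
rewrite ltr_pdivlMr; last by lra.
move=> X2; rewrite mulr_gt0//; first by lra.
have NK : 0 < N * K by nra.
have : X * (N - 1) * (N * K) < 2 * (N * K) by rewrite ltr_pM2r.
(* The two sides differ by (N + 1) (N - 1 - K). *)
suff : 2 * (N * K) <= (N + K + 1) * (N - 1).
  move=> h1 h2; suff : X * (N * K) < N + K + 1 by lra.
  by rewrite -(@ltr_pM2r _ (N - 1)); lra.
nra.
Qed.

(** Limit form of (iv). It amounts to Y + 1 < X J^2 / (2 J + 1), whose right side increases with J,
    so the case J = N + 1 suffices. *)
Lemma ratio_limit (X Y : R) n k0 (N := n.+1%:R) (J := k0.+1%:R) :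
  (n < k0)%N -> 0 < Y ->
  2 < X * N -> N * (N + 1) * Y < N * X - 1 ->
  (1 + 1 / Y) * (J + 1) ^+ 2 < (1 + (X + 1) / Y) * J ^+ 2.
Proof.
move=> nk Y0 X1 h.
have n1 : 1 <= N by rewrite ler1n.
have NJ : N + 1 <= J by rewrite /N /J natr1 ler_nat.
suff : (Y + 1) * (2 * J + 1) < X * J ^+ 2.
  move=> h1; rewrite -subr_gt0.
  have -> : (1 + (X + 1) / Y) * J ^+ 2 - (1 + 1 / Y) * (J + 1) ^+ 2 =
    (X * J ^+ 2 - (Y + 1) * (2 * J + 1)) / Y by field; rewrite gt_eqF.
  by rewrite divr_gt0// subr_gt0.
(* The case J = N + 1; the factor N (N + 1) lets the upper bound on Y eliminate Y. *)
have step : (Y + 1) * (2 * N + 3) < X * (N + 1) ^+ 2.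
  suff : N * (N + 1) * (Y + 1) * (2 * N + 3) < N * (N + 1) * (X * (N + 1) ^+ 2).
    by rewrite -!(mulrA (N * (N + 1))) ltr_pM2l// mulr_gt0//; lra.
  apply: (@lt_trans _ _ ((N * X - 1 + N * (N + 1)) * (2 * N + 3))).
    by rewrite ltr_pM2r; lra.
  rewrite -subr_gt0.
  have -> : N * (N + 1) * (X * (N + 1) ^+ 2)
    - (N * X - 1 + N * (N + 1)) * (2 * N + 3) =
    (X * N - 2) * ((N + 1) ^+ 3 - (2 * N + 3)) + (N ^+ 2 + N - 1) by ring.
  by rewrite ltr_wpDl//; [rewrite mulr_ge0//; nra|nra].
have X0 : 0 < X by nra.
suff : (2 * J + 1) * (N + 1) ^+ 2 <= (2 * N + 3) * J ^+ 2.
  move=> h2; have N2 : 0 < (N + 1) ^+ 2 by rewrite exprn_gt0//; lra.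
  rewrite -(ltr_pM2r N2).
  apply: (@le_lt_trans _ _ ((Y + 1) * ((2 * N + 3) * J ^+ 2))).
    by rewrite -mulrA ler_pM2l//; lra.
  rewrite mulrA [X in _ < X]mulrAC ltr_pM2r// exprn_gt0//; lra.
rewrite -subr_ge0; have d0 : 0 <= J - (N + 1) by lra.
have -> : (2 * N + 3) * J ^+ 2 - (2 * J + 1) * (N + 1) ^+ 2 =
  (J - (N + 1)) * (2 * (N + 1) ^+ 2 + 2 * (N + 1)
    + (2 * N + 3) * (J - (N + 1))) by ring.
by rewrite mulr_ge0//; nra.
Qed.

(** The neighbourhood of (X, Y) serves the compactness argument of (b); the uniformity in alpha
    gives whole fibres [0, pi]. *)
Lemma K_near_interior (X Y : R) k0 n : (1 <= n <= k0)%N -> 0 < Y ->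
  2 / n%:R < X -> ((1 < n)%N -> X < 2 / (n%:R - 1)) ->
  0 < n%:R * X - n%:R * (n%:R + 1) * Y - 1 ->
  \forall q \near (X, Y) & r \near 1^'+,
    forall alpha, 0 <= alpha <= pi -> K k0 n r (q.1, q.2, alpha).
Proof.
case: n => // n /= nk Y0 X1 X2 X3.
have X1' := X1; rewrite ltr_pdivrMr// in X1'.
have nz : 1 <= n.+1%:R :> R by rewrite ler1n.
have X0 : 0 < X by nra.
(* Along this product filter the inequalities [h1] to [h7] relate functions with known limits, so
   strictness in the limit is enough. *)
pose F := filter_prod (nbhs (X, Y)) (at_right (1 : R)).
have cx : z.1.1 @[z --> F] --> X.
  by apply: cvg_comp; [exact: cvg_fst|exact: cvg_fst].
have cy : z.1.2 @[z --> F] --> Y.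
  by apply: cvg_comp; [exact: cvg_fst|exact: cvg_snd].
have cc : z.2 @[z --> F] --> (1 : R).
  apply: cvg_trans; first exact: cvg_snd.
  exact: cvg_within.
pose a (z : R * R * R) := 1 + (z.1.1 + 1) / z.1.2.
pose b (z : R * R * R) := 1 + 1 / z.1.2.
have ca : a z @[z --> F] --> 1 + (X + 1) / Y.
  apply: cvgD; first exact: cvg_cst.
  apply: cvgM; first by apply: cvgD => //; exact: cvg_cst.
  by apply: cvgV => //; rewrite gt_eqF.
have cb : b z @[z --> F] --> 1 + 1 / Y.
  apply: cvgD; first exact: cvg_cst.
  apply: cvgM; first exact: cvg_cst.
  by apply: cvgV => //; rewrite gt_eqF.
set la := 1 + (X + 1) / Y in ca.
set lb := 1 + 1 / Y in cb.
have cT k : T (a z) (b z) z.2 k.+1 @[z --> F] -->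
    la + lb + (k.+1%:R^-1 - (X + 1) / k.+2%:R) / Y.
  by rewrite -T_limit//; apply: cvg_T.
pose W := (n.+1%:R * X - 1) / (n.+1%:R * (n.+1%:R + 1) * Y).
have lT : la + lb + (n.+1%:R^-1 - (X + 1) / n.+2%:R) / Y = la + lb - W.
  have aux (l N : R) : 1 <= N -> l + (N^-1 - (X + 1) / (N + 1)) / Y =
      l - (N * X - 1) / (N * (N + 1) * Y).
    by move=> N1; field; rewrite !gt_eqF//; lra.
  by rewrite /W -[n.+2%:R]natr1 aux.
(* With W > 1, the limits W, 2 W - 1 and W (W - 1) of (i), (ii) and (iii) are all positive. *)
have W1 : 1 < W.
  by rewrite ltr_pdivlMr ?mul1r ?mulr_gt0//; lra.
have cTn := cT n; rewrite lT in cTn.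
have pos (g : R * R * R -> R) l : g z @[z --> F] --> l -> 0 < l ->
  \forall z \near F, 0 <= g z.
  by move=> gl l0; near do apply: ltW; apply: cvgr_gt gl _ l0.
have Yi0 : 0 < 1 / Y by rewrite divr_gt0.
have XYi : la - lb = X / Y by rewrite /la /lb; ring.
have XY0 : 0 < X / Y by rewrite divr_gt0.
have lb1 : 1 < lb by rewrite /lb; lra.
have cc2 : z.2 ^+ 2 @[z --> F] --> (1 ^+ 2 : R) by exact: cvg_exprn.
have h1 : \forall z \near F, 0 <= b z - z.2 ^+ 2.
  by apply: (pos _ _ (cvgB cb cc2)); rewrite expr1n subr_gt0.
(* The limit is (r1^2 - r2^2)^2 = (X / Y)^2, positive because X > 0. *)
have h2 : \forall z \near F, 0 <= (a z + b z + z.2 ^+ 2 - 1) ^+ 2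
    - 4 * a z * b z * z.2 ^+ 2.
  apply: (pos _ ((la + lb + 1 ^+ 2 - 1) ^+ 2 - 4 * la * lb * 1 ^+ 2)).
    apply: cvgB; last by do 3?apply: cvgM => //; exact: cvg_cst.
    apply: cvg_exprn; apply: cvgB; last exact: cvg_cst.
    by do 2?apply: cvgD.
  have -> : (la + lb + 1 ^+ 2 - 1) ^+ 2 - 4 * la * lb * 1 ^+ 2 = (la - lb) ^+ 2.
    by ring.
  by rewrite XYi exprn_gt0.
(* The finite type allows a finite intersection of neighbourhoods; the ordinal k stands for the
   index k+1. *)
have h3 : \forall z \near F, forall k : 'I_k0.+1, (k : nat) <> n ->
    T (a z) (b z) z.2 n.+1 <= T (a z) (b z) z.2 k.+1.
  apply: filter_forall => k; have [->|/eqP kn] := eqVneq (k : nat) n.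
    exact: nearW.
  near=> z => _; rewrite -subr_ge0; near: z.
  apply: (pos _ _ (cvgB (cT k) (cT n))).
  rewrite subr_gt0 ltrD2l ltr_pM2r ?invr_gt0//.
  exact: T_limit_lt.
have h4 : \forall z \near F, 0 <= a z + b z - z.2 * T (a z) (b z) z.2 n.+1.
  apply: (pos _ (la + lb - 1 * (la + lb - W))).
    by apply: cvgB; [exact: cvgD|exact: cvgM].
  lra.
have h5 : \forall z \near F, 0 <= 2 * z.2 ^+ 2 * (a z + b z)
    - 2 * z.2 * T (a z) (b z) z.2 n.+1 - 1.
  apply: (pos _ (2 * 1 ^+ 2 * (la + lb) - 2 * 1 * (la + lb - W) - 1)).
    apply: cvgB; last exact: cvg_cst.
    apply: cvgB; apply: cvgM => //; last by apply: cvgM => //; exact: cvg_cst.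
      by apply: cvgM => //; exact: cvg_cst.
    exact: cvgD.
  lra.
have h6 : \forall z \near F, 0 <= z.2 ^+ 2 * T (a z) (b z) z.2 n.+1 ^+ 2
    + z.2 * T (a z) (b z) z.2 n.+1 * (1 - 2 * z.2 ^+ 2 * (a z + b z))
    + (4 * a z * b z * z.2 ^+ 4 + z.2 ^+ 2 * (a z - b z) ^+ 2
       - a z - b z - z.2 ^+ 2 + 1).
  apply: (pos _ (1 ^+ 2 * (la + lb - W) ^+ 2
    + 1 * (la + lb - W) * (1 - 2 * 1 ^+ 2 * (la + lb))
    + (4 * la * lb * 1 ^+ 4 + 1 ^+ 2 * (la - lb) ^+ 2
       - la - lb - 1 ^+ 2 + 1))).
    apply: cvgD.
      apply: cvgD.
        by apply: cvgM => //; exact: cvg_exprn.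
      apply: cvgM; first exact: cvgM.
      apply: cvgB; first exact: cvg_cst.
      apply: cvgM; last exact: cvgD.
      by apply: cvgM => //; exact: cvg_cst.
    apply: cvgD; last exact: cvg_cst.
    do 3?apply: cvgB => //.
    apply: cvgD; apply: cvgM => //.
    - by do 2?apply: cvgM => //; exact: cvg_cst.
    - exact: cvg_exprn.
    - by apply: cvg_exprn; exact: cvgB.
  have -> : 1 ^+ 2 * (la + lb - W) ^+ 2
    + 1 * (la + lb - W) * (1 - 2 * 1 ^+ 2 * (la + lb))
    + (4 * la * lb * 1 ^+ 4 + 1 ^+ 2 * (la - lb) ^+ 2
       - la - lb - 1 ^+ 2 + 1) = W * (W - 1) by ring.
  by rewrite mulr_gt0//; lra.
have h7 : \forall z \near F,
    0 <= a z * U z.2 k0.+1 ^+ 2 - b z * U z.2 k0.+2 ^+ 2.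
  apply: (pos _ (la * k0.+1%:R ^+ 2 - lb * k0.+2%:R ^+ 2)).
    by apply: cvgB; apply: cvgM => //; apply: cvg_exprn; exact: cvg_U.
  by rewrite subr_gt0 -[k0.+2%:R]natr1; apply: (@ratio_limit _ _ n) => //; lra.
suff : \forall z \near F, forall alpha, 0 <= alpha <= pi ->
  K k0 n.+1 z.2 (z.1.1, z.1.2, alpha) by [].
near=> z => alpha halpha; apply: K_sufficient => //.
- by near: z; apply: (cvg_snd (nbhs_right_gt 1)).
- by near: z; apply: cvgr_gt cy _ Y0.
- by near: z; apply: (pos _ _ cx).
- by rewrite -subr_ge0; near: z.
- by rewrite -subr_ge0; near: z.
- case=> // k /= hk kn.
  have := near h3 z _ (Ordinal hk); apply => //=.
  by move=> kn'; apply: kn; rewrite kn'.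
- by near: z.
- by near: z.
- by near: z.
- by rewrite -subr_ge0; near: z.
Unshelve. all: by end_near. Qed.

End Near.

(** * The two Kuratowski limits *)

Section Main.
Context {R : realType}.

Lemma cvg_triple {I : Type} (F : set_system I) {FF : Filter F}
    (a : I -> R * R * R) (p : R * R * R) : a i @[i --> F] --> p ->
  [/\ (a i).1.1 @[i --> F] --> p.1.1, (a i).1.2 @[i --> F] --> p.1.2 &
      (a i).2 @[i --> F] --> p.2].
Proof.
case: p => -[X Y] alpha ap /=.
have ap1 : (a i).1 @[i --> F] --> (X, Y).
  by apply: cvg_comp ap _; exact: cvg_fst.
split.
- by apply: (cvg_comp _ _ ap1); exact: cvg_fst.
- by apply: (cvg_comp _ _ ap1); exact: cvg_snd.
- by apply: cvg_comp ap _; exact: cvg_snd.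
Qed.

(** The inequalities defining P_n are weak and pass to the limit, except Y > 0, which [upper p]
    supplies. *)
Lemma P_closed n (a : nat -> R * R * R) p : upper p -> a i @[i --> \oo] --> p ->
  (forall i, P n (a i)) -> P n p.
Proof.
move=> p0 /cvg_triple [aX aY aA] Pa.
have {}Pa i :
    [/\ 0 < (a i).1.2, XYcond n (a i).1.1 (a i).1.2 & 0 <= (a i).2 <= pi].
  by have := Pa i; case: (a i) => -[].
suff : [/\ 0 < p.1.2, XYcond n p.1.1 p.1.2 & 0 <= p.2 <= pi].
  by clear; case: p => -[].
split => //.
- split.
  + by apply: (cvgr_to_ge aX); apply: nearW => i; have [_ []] := Pa i.
  + move=> n1; apply: (cvgr_to_le aX); apply: nearW => i.
    by have [_ [_ h _] _] := Pa i; exact: h.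
  + apply: (@cvgr_to_ge _ \oo _ _ (fun i => n%:R * (a i).1.1
      - n%:R * (n%:R + 1) * (a i).1.2 - 1)); last first.
      by apply: nearW => i; have [_ []] := Pa i.
    apply: cvgB; last exact: cvg_cst.
    by apply: cvgB; apply: cvgM => //; exact: cvg_cst.
- apply/andP; split.
  + by apply: (cvgr_to_ge aA); apply: nearW => i; have [_ _ /andP[]] := Pa i.
  + by apply: (cvgr_to_le aA); apply: nearW => i; have [_ _ /andP[]] := Pa i.
Qed.

(** For n >= 2, X is bounded on both sides, so points move along segments to one interior point, P_n
    being convex in (X, Y). The other half is [P_closed], as [Ktilde] lies in P_n. *)
Lemma klimit_Ktilde k0 n : (2 <= n <= k0)%N ->
  klimit (fun r3 : R => Ktilde k0 n r3) (P n).
Proof.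
move=> /andP[n2 nk]; split.
- by move=> [[X Y] alpha] [].
- move=> [[X Y] alpha] [Y0 [X1 X2 X3] halpha].
  have n1 : 2 <= n%:R :> R by rewrite ler_nat.
  have {}X2 := X2 n2.
  pose N : R := n%:R; rewrite -/N in X1 X2 X3 n1.
  (* [x] is the midpoint of the range of X, so N x > 2, while N (N + 1) y = 1/2; this makes the last
     condition strict. *)
  pose x : R := (2 / N + 2 / (N - 1)) / 2.
  pose y : R := (2 * (N * (N + 1)))^-1.
  have NN0 : 0 < 2 * (N * (N + 1)) by rewrite !mulr_gt0//; lra.
  have y0 : 0 < y by rewrite invr_gt0.
  have lt2 : 2 / N < 2 / (N - 1).
    by rewrite ltr_pM2l// ltf_pV2 ?posrE; lra.
  have x1 : 2 / N < x by rewrite /x; lra.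
  have x2 : x < 2 / (N - 1) by rewrite /x; lra.
  have x3 : 0 < N * x - N * (N + 1) * y - 1.
    have : 2 < N * x by move: x1; rewrite ltr_pdivrMr 1?mulrC//; lra.
    have : 2 * (N * (N + 1)) * y = 1 by rewrite mulfV ?gt_eqF.
    by lra.
  pose X' h := X + h * (x - X); pose Y' h := Y + h * (y - Y).
  have in' h : 0 < h < 1 -> [/\ 0 < Y' h, 2 / N < X' h, X' h < 2 / (N - 1) &
      0 < N * X' h - N * (N + 1) * Y' h - 1].
    move=> /andP[h0 h1]; rewrite /X' /Y'; split; only 1-3: nra.
    have -> : N * (X + h * (x - X)) - N * (N + 1) * (Y + h * (y - Y)) - 1 =
      (1 - h) * (N * X - N * (N + 1) * Y - 1)
      + h * (N * x - N * (N + 1) * y - 1) by ring.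
    by rewrite ltr_wpDl// ?mulr_gt0// mulr_ge0//; lra.
  have [|h [h0 hK]] := @vanishing_selection R
    (fun r h => K k0 n r (X' h, Y' h, alpha)).
    move=> h h0 h1; have [|a1 a2 a3 a4] := in' h; first by apply/andP.
    have := @K_near_interior R (X' h) (Y' h) k0 n.
    rewrite nk (ltnW n2) => /(_ isT a1 a2 (fun=> a3) a4) Kn.
    case: Kn => -[A B] /= [nA nB] AB; apply: filterS nB => r Br.
    by apply: (AB ((X' h, Y' h), r)) => //; split=> //; exact: nbhs_singleton.
  exists (fun r => (X' (h r), Y' (h r), alpha)); split.
    near=> r.
    have [hr Kr] : 0 < h r < 1 /\ K k0 n r (X' (h r), Y' (h r), alpha).
      by near: r.
    have [a1 a2 a3 a4] := in' _ hr.
    by split => //; split => [|_|]; exact: ltW.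
  have lin (u w : R) : u + h r * (w - u) @[r --> 1^'+] --> u.
    suff : u + h r * (w - u) @[r --> 1^'+] --> u + 0 * (w - u).
      by rewrite mul0r addr0.
    apply: cvgD; first exact: cvg_cst.
    by apply: cvgM => //; exact: cvg_cst.
  exact: cvg_pair (cvg_pair (lin _ _) (lin _ _)) (cvg_cst alpha).
- move=> p p0 r a r1 rto Ka ap; apply: (P_closed p0 ap) => i.
  have := Ka i; case: (a i) => -[X Y] alpha [[[[r1' r2'] al]]].
  move=> [[al1 r31 r32 r21 _] _] [_ <- <-] XYc; split => //.
  by rewrite divr_gt0// subr_gt0; nra.
Unshelve. all: by end_near. Qed.

(** For n = 1 nothing bounds X above, so one translation X + h moves all of C into the interior and
    keeps it compact. *)
Lemma klimit_compact k0 (C : set (R * R)) : (1 <= k0)%N ->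
  C `<=` [set q | 0 < q.2] -> compact C ->
  C `*` [set alpha : R | 0 <= alpha <= pi] `<=` P 1 ->
  exists CK : R -> set (R * R * R),
    (forall r3 : R, 1 < r3 -> compact (CK r3) /\ CK r3 `<=` K k0 1 r3) /\
    klimit CK (C `*` [set alpha : R | 0 <= alpha <= pi]).
Proof.
move=> k01 C0 Cc CP; set A := [set alpha : R | 0 <= alpha <= pi].
have Ac : compact A.
  have -> : A = `[0, pi]%classic by apply/seteqP; split => x /=; rewrite in_itv.
  exact: segment_compact.
pose g (h : R) (q : R * R) := (q.1 + h, q.2).
have gc h : compact (g h @` C).
  apply: continuous_compact => //; apply: continuous_subspaceT => q.
  apply: (cvg_pair (G := nbhs _) (H := nbhs _)); last exact: cvg_snd.
  by apply: cvgD; [exact: cvg_fst|exact: cvg_cst].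
have [|h [h0 hK]] := @vanishing_selection R
  (fun r h => (g h @` C) `*` A `<=` K k0 1 r).
  move=> h h0 h1.
  (* Compactness turns the ranges of r found around each point into a common one. *)
  have near_K : \forall r \near 1^'+, g h @` C `<=` [set q |
      forall alpha, 0 <= alpha <= pi -> K k0 1 (r : R) (q.1, q.2, alpha)].
    apply: (compact_near_coveringP _).1 => // _ [[X Y] Cq <-].
    have [Y0 [X1 _ X2] _] : P 1 ((X, Y), 0 : R).
      by apply: CP; split=> //=; rewrite lexx pi_ge0.
    rewrite invr1 mulr1 !mul1r in X1 X2.
    by apply: K_near_interior => //=; rewrite ?invr1 ?mulr1 ?mul1r; lra.
  apply: filterS near_K => r Kr [[X Y] alpha] [/= CXY Aalpha].
  exact: (Kr _ CXY).
(* Containment in K_1 is required for every r3 > 1 but known only near 1; the guard makes [CK r]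
   empty where it fails. *)
pose CK r := [set p | (g (h r) @` C) `*` A `<=` K k0 1 r /\
  ((g (h r) @` C) `*` A) p].
exists CK; split => [r r1|].
  split; last by move=> p [HK Hp]; exact: HK.
  have [HK|HK] := pselect ((g (h r) @` C) `*` A `<=` K k0 1 r).
    have -> : CK r = (g (h r) @` C) `*` A by apply/seteqP; split => p // [].
    exact: compact_setX.
  have -> : CK r = set0 by apply/seteqP; split => p // [].
  exact: compact0.
split.
- by move=> [q alpha] [/= Cq _]; exact: C0.
- move=> [[X Y] alpha] [/= Cq Aalpha].
  exists (fun r => (g (h r) (X, Y), alpha)); split.
    near=> r; split; last by split => //; exists (X, Y).
    by apply: (proj2 (_ : 0 < h r < 1 /\ _)); near: r.
  suff cX : X + h r @[r --> 1^'+] --> X.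
    exact: cvg_pair (cvg_pair cX (cvg_cst Y)) (cvg_cst alpha).
  suff : X + h r @[r --> 1^'+] --> X + 0 by rewrite addr0.
  by apply: cvgD; first exact: cvg_cst.
- move=> [q alpha] _ r a r1 rto Ka /cvg_triple [/= aX aY aA].
  have hr : h (r i) @[i --> \oo] --> (0 : R).
    by apply: (cvg_at_rightP h 1 0).1.
  (* Undoing the translation returns the sequence to the closed set C, with the same limit since
     h(r_i) tends to 0. *)
  have Ca i : C ((a i).1.1 - h (r i), (a i).1.2).
    by have [_ [[[x y] Cxy <-] _]] := Ka i; rewrite /= addrK.
  split => /=.
    apply: (@closed_cvg _ _ \oo _
      (fun i => ((a i).1.1 - h (r i), (a i).1.2)) C).
    - by apply: compact_closed => //; exact: norm_hausdorff.
    - by apply: nearW => i; exact: Ca.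
    - case: q aX aY => X Y /= aX aY.
      suff cX : (a i).1.1 - h (r i) @[i --> \oo] --> X.
        exact: cvg_pair cX aY.
      suff : (a i).1.1 - h (r i) @[i --> \oo] --> X - 0 by rewrite subr0.
      exact: cvgB.
  have Aa i : 0 <= (a i).2 <= pi by have [_ []] := Ka i.
  apply/andP; split.
  + by apply: (cvgr_to_ge aA); apply: nearW => i; have /andP[] := Aa i.
  + by apply: (cvgr_to_le aA); apply: nearW => i; have /andP[] := Aa i.
Unshelve. all: by end_near. Qed.

End Main.

Theorem proposition7p2 (R : realType) (k0 : nat) (hk0 : (1 <= k0)%N) :
  (forall n : nat, (2 <= n <= k0)%N ->
     klimit (fun r3 : R => Ktilde k0 n r3) (P n)) /\
  (forall C : set (R * R),
     C `<=` [set q | 0 < q.2] -> compact C ->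
     C `*` [set alpha : R | 0 <= alpha <= pi] `<=` P 1 ->
     exists CK : R -> set (R * R * R),
       (forall r3 : R, 1 < r3 -> compact (CK r3) /\ CK r3 `<=` K k0 1 r3) /\
       klimit CK (C `*` [set alpha : R | 0 <= alpha <= pi])).
Proof.
split => [n|C C0 Cc CP]; first exact: klimit_Ktilde.
exact: klimit_compact.
Qed.
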